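(* Let $d \ge 3$. Let $m_1,m_2,n_1,n_2$ be four distinct integers in $\{0,1,\dots,d\}$, with $\{m_1,m_2\} \ne \{0,1\}$ and $\{m_1,m_2\}\ne\{d-1,d\}$, and set $\mathcal{B}=\{m_1,m_2,n_1,n_2\}$. Then for a general binary form $p \in H_d(\mathbb{C}^2)$ there exist an invertible linear change of variables $(X,Y) = (\alpha_1x+\alpha_2y,\ \alpha_3x+\alpha_4y)$ and constants $t_k\in\mathbb{C}$ ($k\in\{0,\dots,d\}\setminus\mathcal{B}$) such that $$p(x,y) = X^{d-n_1}Y^{n_1} + X^{d-n_2}Y^{n_2} + \sum_{k \in \{0,\dots,d\}\setminus \mathcal{B}} t_k X^{d-k}Y^k.$$ In particular, the monomials $X^{d-m_1}Y^{m_1}$ and $X^{d-m_2}Y^{m_2}$ do not appear.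
   Context: $H_d(\mathbb{C}^n)$ denotes the complex vector space of homogeneous polynomials of degree $d$ in $n$ variables. ''A general $p$ has property P'' means P holds for all $p$ in a nonempty Zariski-open subset of $H_d(\mathbb{C}^n)$. *)

(* Defs.v *)
From HB Require Import structures.
From mathcomp Require Import all_boot all_order all_algebra.
Set Implicit Arguments. Unset Strict Implicit. Unset Printing Implicit Defensive.
Import Order.TTheory GRing.Theory Num.Theory.
Local Open Scope ring_scope.

Definition mpoly (C : ringType) (n : nat) := seq (C * {ffun 'I_n -> nat}).

Definition meval (C : comRingType) (n : nat) (f : mpoly C n)
    (c : {ffun 'I_n -> C}) : C :=
  \sum_(m <- f) m.1 * \prod_(i < n) c i ^+ m.2 i.

Definition zariski_open (C : comRingType) (n : nat)
    (U : {ffun 'I_n -> C} -> Prop) : Prop :=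
  exists S : mpoly C n -> Prop,
    forall c, U c <-> ~ (forall f, S f -> meval f c = 0).

Definition general (C : comRingType) (n : nat)
    (P : {ffun 'I_n -> C} -> Prop) : Prop :=
  exists U, zariski_open U /\ (exists c, U c) /\ (forall c, U c -> P c).

(* ---- Binary forms, as elements of {poly {poly C}}:
   the inner variable is x (= 'X%:P), the outer variable is y (= 'X). ---- *)
Definition bx (C : nzRingType) : {poly {poly C}} := ('X)%:P.
Definition by_ (C : nzRingType) : {poly {poly C}} := 'X.
Definition bconst (C : nzRingType) (a : C) : {poly {poly C}} := a%:P%:P.

(* H_d(C^2) is identified with C^(d+1) via coefficients:
   p = \sum_k c_k x^(d-k) y^k. *)
Definition binform (C : nzRingType) (d : nat) (c : {ffun 'I_d.+1 -> C})
    : {poly {poly C}} :=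
  \sum_(k < d.+1) bconst (c k) * bx C ^+ (d - k) * by_ C ^+ k.

(* Main.v *)
(* The map sending a substitution and the free coefficients t_k to the resulting form is
   polynomial between affine spaces of equal dimension. By quantifier elimination its image is
   constructible, so it contains a nonempty open set unless it lies in a hypersurface h = 0.
   The latter is impossible if at some point the differential is onto: along curves with
   prescribed velocity, the lowest-order part of h at the image point would vanish identically.
   At the identity substitution the differential is onto as soon as one 2 x 2 minor in the
   coefficients next to m1 and m2 is nonzero; the excluded pairs {0, 1} and {d-1, d} are those
   for which this minor vanishes identically. *)
From mathcomp Require Import closed_field ring zify.
From mathcomp Require Import mpoly.
Require Import Defs.
From HB Require Import structures.
From mathcomp Require Import all_boot all_order all_algebra.
Import Order.TTheory GRing.Theory Num.Theory.
Local Open Scope ring_scope.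
Set Implicit Arguments. Unset Strict Implicit.

(** * Non-roots of polynomials in several variables *)

Lemma coef_muni (R : comNzRingType) (n : nat) (p : {mpoly R[n.+1]})
    (m : 'X_{1..n.+1}) :
  (muni p)`_(m ord_max)@_[multinom m (widen_ord (leqnSn n) i) | i < n] = p@_m.
Proof.
rewrite muniE coef_sum (raddf_sum (mcoeff _)) /= {3}[p]mpolyE raddf_sum /=.
apply: eq_bigr => m' _; rewrite coefZ coefXn mulr_natr mcoeffMn !mcoeffZ !mcoeffX.
rewrite -mulrnAr -mulrnA mulnb; congr (_ * _%:R); congr nat_of_bool.
apply/andP/eqP => [[/eqP/mnmP e1 /eqP e2]|->]; last by rewrite !eqxx.
apply/mnmP => i; case: (unliftP ord_max i) => [j ->|-> //].
have := e1 j; rewrite !mnmE.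
suff -> : widen_ord (leqnSn n) j = lift ord_max j by [].
by apply: val_inj; rewrite /= /bump leqNgt ltn_ord.
Qed.

(** Induction on the number of variables: once [v] avoids the zeros of the leading coefficient in
    the last variable, a nonzero univariate polynomial remains, and a closed field contains a
    non-root of it. *)
Lemma mpoly_nonvanish (F : closedFieldType) (n : nat) (p : {mpoly F[n]}) :
  p != 0 -> exists v, p.@[v] != 0.
Proof.
elim: n p => [|n IHn] p nzp.
  by exists (fun=> 0); move: nzp; rewrite [p]nvar0_mpolyC mevalC mpolyC_eq0.
have /IHn [v nzv] : lead_coef (muni p) != 0.
  rewrite lead_coef_eq0.
  apply: contraNneq nzp => mp0; apply/eqP/mpolyP => m.
  by rewrite -coef_muni mp0 coef0 !mcoeff0.
have /closed_nonrootP [x] : map_poly (mpoly.meval v) (muni p) != 0.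
  apply: contraNneq nzv => /polyP/(_ (size (muni p)).-1).
  by rewrite coef_map coef0 lead_coefE => ->.
rewrite /root => nzx; pose w (i : 'I_n.+1) := if unlift ord_max i is Some j then v j else x.
exists w; apply: contraNneq nzx => <-; apply/eqP; rewrite mevalE muniE rmorph_sum /= horner_sum.
apply: eq_bigr => m _; rewrite map_polyZ /= map_polyXn !hornerE.
rewrite mevalZ mevalX -mulrA; congr (_ * _).
rewrite big_ord_recr /= {2}/w unlift_none; congr (_ * _).
apply: eq_bigr => j _; rewrite mnmE /w.
have -> : widen_ord (leqnSn n) j = lift ord_max j.
  by apply: val_inj; rewrite /= /bump leqNgt ltn_ord.
by rewrite liftK.
Qed.

(** * Generic truth of formulas and images of polynomial maps *)

(** The value at [GRing.Inv] is a default: evaluations are compared only on terms satisfying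
    [GRing.rterm], which contain no inverse. *)
Fixpoint mpoly_of_term (F : fieldType) (n : nat) (t : GRing.term F) : {mpoly F[n]} :=
  match t with
  | GRing.Var i => if insub i is Some j then 'X_j else 0
  | GRing.Const x => x%:MP
  | GRing.NatConst k => k%:R
  | GRing.Add t1 t2 => mpoly_of_term n t1 + mpoly_of_term n t2
  | GRing.Opp t1 => - mpoly_of_term n t1
  | GRing.NatMul t1 k => mpoly_of_term n t1 *+ k
  | GRing.Mul t1 t2 => mpoly_of_term n t1 * mpoly_of_term n t2
  | GRing.Inv t1 => 0
  | GRing.Exp t1 k => mpoly_of_term n t1 ^+ k
  end.

Lemma eval_mpoly_of_term (F : fieldType) (n : nat) (v : 'I_n -> F) (t : GRing.term F) :
  GRing.rterm t ->
  GRing.eval [seq v i | i <- enum 'I_n] t = (mpoly_of_term n t).@[v].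
Proof.
elim: t => //=.
- move=> i _; case: insubP => [j _ <-|]; last first.
    by rewrite -leqNgt => lein; rewrite meval0 nth_default // size_map size_enum_ord.
  rewrite mevalXU (nth_map (j : 'I_n)) ?size_enum_ord ?ltn_ord //.
  by rewrite (nth_ord_enum j (j : 'I_n)).
- by move=> x _; rewrite mevalC.
- by move=> k _; rewrite mevalMn meval1.
- by move=> t1 IH1 t2 IH2 /andP[/IH1 -> /IH2 ->]; rewrite mevalD.
- by move=> t1 IH1 /IH1 ->; rewrite mevalN.
- by move=> t1 IH1 k /IH1 ->; rewrite mevalMn.
- by move=> t1 IH1 t2 IH2 /andP[/IH1 -> /IH2 ->]; rewrite mevalM.
- by move=> t1 IH1 k /IH1 ->; rewrite rmorphXn.
Qed.

(** An equation is either an identity, hence always true, or false off the hypersurface it defines.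
    Connectives multiply the two polynomials, so that both truth values are fixed where the product
    is nonzero. *)
Lemma qf_generic (F : fieldType) (n : nat) (f : GRing.formula F) :
  GRing.qf_form f -> GRing.rformula f ->
  exists (h : {mpoly F[n]}) (b : bool), h != 0 /\
    forall v, h.@[v] != 0 -> GRing.qf_eval [seq v i | i <- enum 'I_n] f = b.
Proof.
have two b1 b2 g (h1 h2 : {mpoly F[n]}) f1 f2 (op : bool -> bool -> bool) :
    h1 != 0 -> h2 != 0 ->
    (forall v, h1.@[v] != 0 -> f1 v = b1) -> (forall v, h2.@[v] != 0 -> f2 v = b2) ->
    (forall v, g v = op (f1 v) (f2 v)) ->
  exists (h : {mpoly F[n]}) (b : bool), h != 0 /\
    forall v, h.@[v] != 0 -> g v = b.
  move=> nz1 nz2 H1 H2 gE; exists (h1 * h2), (op b1 b2); split; first exact: mulf_neq0.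
  move=> v; rewrite mevalM mulf_eq0 => /norP[/H1 e1 /H2 e2].
  by rewrite gE e1 e2.
elim: f => //=.
- by move=> b _ _; exists 1, b; rewrite oner_eq0.
- move=> t1 t2 _ /andP[r1 r2].
  have E v : (GRing.eval [seq v i | i <- enum 'I_n] t1
      == GRing.eval [seq v i | i <- enum 'I_n] t2)
      = ((mpoly_of_term n t1 - mpoly_of_term n t2).@[v] == 0).
    by rewrite !eval_mpoly_of_term // mevalB subr_eq0.
  have [h0|nz] := eqVneq (mpoly_of_term n t1 - mpoly_of_term n t2) 0.
    by exists 1, true; split; [exact: oner_neq0 | move=> v _; rewrite E h0 meval0 eqxx].
  by eexists _, false; split; [exact: nz | move=> v /negPf hv; rewrite E].
- move=> f1 IH1 f2 IH2 /andP[q1 q2] /andP[r1 r2].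
  have [h1 [b1 [nz1 H1]]] := IH1 q1 r1; have [h2 [b2 [nz2 H2]]] := IH2 q2 r2.
  exact: (two b1 b2 _ _ _ _ _ andb nz1 nz2 H1 H2).
- move=> f1 IH1 f2 IH2 /andP[q1 q2] /andP[r1 r2].
  have [h1 [b1 [nz1 H1]]] := IH1 q1 r1; have [h2 [b2 [nz2 H2]]] := IH2 q2 r2.
  exact: (two b1 b2 _ _ _ _ _ orb nz1 nz2 H1 H2).
- move=> f1 IH1 f2 IH2 /andP[q1 q2] /andP[r1 r2].
  have [h1 [b1 [nz1 H1]]] := IH1 q1 r1; have [h2 [b2 [nz2 H2]]] := IH2 q2 r2.
  exact: (two b1 b2 _ _ _ _ _ implb nz1 nz2 H1 H2).
- move=> f1 IH1 q1 r1; have [h1 [b1 [nz1 H1]]] := IH1 q1 r1.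
  by exists h1, (~~ b1); split=> // v /H1 ->.
Qed.

(** The offset [k] leaves the first [k] variables of the formula free for the target coordinates. *)
Definition term_of_mpoly (F : fieldType) (k m : nat) (p : {mpoly F[m]}) : GRing.term F :=
  \big[@GRing.Add F/GRing.NatConst F 0]_(u <- msupp p)
    GRing.Mul (GRing.Const p@_u)
      (\big[@GRing.Mul F/GRing.NatConst F 1]_(j < m) GRing.Exp (GRing.Var F (k + j)) (u j)).

Lemma eval_term_of_mpoly (F : fieldType) (k m : nat) (p : {mpoly F[m]}) (e : seq F) :
  GRing.eval e (term_of_mpoly k p) = p.@[fun j => e`_(k + j)].
Proof.
rewrite /term_of_mpoly mevalE.
rewrite (big_morph (GRing.eval e) (id1 := 0) (op1 := +%R)) //.
apply: eq_bigr => u _ /=; congr (_ * _).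
by rewrite (big_morph (GRing.eval e) (id1 := 1) (op1 := *%R)).
Qed.

Lemma holds_bigAnd (F : fieldType) (I : finType) (f : I -> GRing.formula F) (e : seq F) :
  GRing.holds e (\big[@GRing.And F/@GRing.Bool F true]_i f i) <-> forall i, GRing.holds e (f i).
Proof.
suff H (r : seq I) : GRing.holds e (\big[@GRing.And F/@GRing.Bool F true]_(i <- r) f i)
    <-> {in r, forall i, GRing.holds e (f i)}.
  by rewrite H; split=> Hf i *; apply: Hf; rewrite ?mem_index_enum.
elim: r => [|i r IHr]; first by rewrite big_nil.
rewrite big_cons /= IHr; split=> [[Hi Hr] j|Hr]; last first.
  by split=> [|j jr]; apply: Hr; rewrite inE ?eqxx ?jr ?orbT.
by rewrite inE => /predU1P[->|/Hr].
Qed.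

(** A weak form of Chevalley's theorem: membership in the image of the locus [D] nonzero is an
    existential formula, which quantifier elimination turns into one covered by [qf_generic]. *)
Lemma image_generic (F : closedFieldType) (n m : nat) (G : 'I_n -> {mpoly F[m]})
    (D : {mpoly F[m]}) :
  exists (h : {mpoly F[n]}) (b : bool), h != 0 /\ forall v, h.@[v] != 0 ->
    (exists t, D.@[t] != 0 /\ forall i, v i = (G i).@[t]) <-> b.
Proof.
pose f := foldr (@GRing.Exists F)
  (GRing.And (GRing.Not (GRing.Equal (term_of_mpoly n D) (GRing.NatConst F 0)))
    (\big[@GRing.And F/@GRing.Bool F true]_(i < n)
      GRing.Equal (GRing.Var F i) (term_of_mpoly n (G i)))) (iota n m).
pose g := GRing.quantifier_elim (@ClosedFieldQE.ex_elim F) (GRing.to_rform f).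
have gP e := GRing.quantifier_elim_rformP (@ClosedFieldQE.wf_ex_elim F)
  (ClosedFieldQE.holds_ex_elim (@solve_monicpoly F)) e (GRing.to_rform_rformula f).
have /andP[qg rg] : GRing.qf_form g && GRing.rformula g.
  exact: GRing.quantifier_elim_wf (@ClosedFieldQE.wf_ex_elim F) _ (GRing.to_rform_rformula f).
have [h [b [nzh hb]]] := qf_generic n qg rg.
exists h, b; split=> // v /hb <-.
set e := [seq v i | i <- enum 'I_n].
have sz_e : size e = n by rewrite size_map size_enum_ord.
have eE (i : 'I_n) : e`_i = v i.
  by rewrite (nth_map i) ?size_enum_ord ?ltn_ord // nth_ord_enum.
split=> [[t [nzD vG]]|/gP/GRing.to_rformP/GRing.foldExistsP[e' ee' /= [nzD /holds_bigAnd vG]]].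
  apply/gP/GRing.to_rformP/GRing.foldExistsP.
  pose e' := e ++ [seq t j | j <- enum 'I_m].
  have e't : (fun j : 'I_m => e'`_(n + j)) =1 t.
    move=> j; rewrite nth_cat sz_e ltnNge leq_addr /= addKn.
    by rewrite (nth_map j) ?size_enum_ord ?ltn_ord // nth_ord_enum.
  exists e'.
    (* Outside the quantified indices the environments agree: below [n] by construction, from
       [n + m] on because both read the default 0. *)
    move=> i; rewrite inE /= mem_iota nth_cat sz_e negb_and -ltnNge -leqNgt.
    case: ltnP => //= le_ni le_mi; rewrite !nth_default ?sz_e //.
    by rewrite size_map size_enum_ord leq_subRL.
  split; first by rewrite /= eval_term_of_mpoly (meval_eq _ e't); apply/eqP.
  apply/holds_bigAnd => i /=.
  by rewrite eval_term_of_mpoly (meval_eq _ e't) nth_cat sz_e ltn_ord eE.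
exists (fun j => e'`_(n + j)); split.
  by move/eqP: nzD; rewrite eval_term_of_mpoly.
move=> i; rewrite -eE -eval_term_of_mpoly -(vG i) /= ee' //.
by rewrite inE /= mem_iota leqNgt ltn_ord.
Qed.

(** * Dominance criterion by curves with prescribed velocity *)

Lemma horner_mmap (F : fieldType) (m : nat) (g : 'I_m -> {poly F}) (p : {mpoly F[m]}) (x : F) :
  (mmap polyC g p).[x] = p.@[fun j => (g j).[x]].
Proof.
rewrite mevalE /mmap horner_sum; apply: eq_bigr => u _.
rewrite hornerM hornerC horner_prod; congr (_ * _).
by apply: eq_bigr => j _; rewrite horner_exp.
Qed.

Lemma poly_vanish (F : closedFieldType) (p : {poly F}) :
  (forall x, p.[x] = 0) -> p = 0.
Proof.
move=> p0; apply/eqP/negPn/negP => /closed_nonrootP [x].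
by rewrite /root p0 eqxx.
Qed.

Lemma mpoly_shift (F : closedFieldType) (n : nat) (h : {mpoly F[n]}) (a : 'I_n -> F) :
  h != 0 -> exists2 g : {mpoly F[n]}, g != 0 & forall v, h.@[v] = g.@[fun i => v i - a i].
Proof.
move=> nzh; pose g := h \mPo [tuple 'X_i + (a i)%:MP | i < n].
have hg v : h.@[v] = g.@[fun i => v i - a i].
  rewrite comp_mpoly_meval; apply: meval_eq => i.
  by rewrite tnth_mktuple mevalD mevalXU mevalC subrK.
exists g => //; have [v nzv] := mpoly_nonvanish nzh.
by apply: contraNneq nzv => g0; rewrite hg g0 meval0.
Qed.

(* The direction w is chosen off the tangent cone at a of the hypersurface h = 0. *)
Lemma jet_nonvanish (F : closedFieldType) (n : nat) (h : {mpoly F[n]}) (a : 'I_n -> F) :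
  h != 0 -> exists w : 'I_n -> F, forall u : 'I_n -> {poly F},
    (forall i, (u i)`_0 = a i /\ (u i)`_1 = w i) -> mmap polyC u h != 0.
Proof.
case/(mpoly_shift a) => g nzg hg.
(* The least degree [r] of a monomial of the translate [g] is the order of vanishing of [h] at [a];
   the homogeneous part of degree [r] defines the tangent cone. *)
have ex_r : exists r, has (fun m => mdeg m == r) (msupp g).
  move: nzg; rewrite -msupp_eq0; case: (msupp g) => // m s _.
  by exists (mdeg m); rewrite /= eqxx.
case: (ex_minnP ex_r) => r /hasP[m0 m0g /eqP deg_m0] min_r.
have nz_gr : pihomog mdeg r g != 0.
  apply: contraTneq m0g => /(congr1 (mcoeff m0)).
  rewrite mcoeff0 mcoeff_msupp negbK pihomogE raddf_sum /= -big_filter.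
  rewrite (eq_bigr (fun m => if m == m0 then g@_m else 0)); last first.
    by move=> m _; rewrite mcoeffZ mcoeffX; case: eqP => _; rewrite ?mulr1 ?mulr0.
  case g0: (g@_m0 == 0) => //.
  rewrite (bigD1_seq m0) ?filter_uniq ?msupp_uniq //=; last first.
    by rewrite mem_filter deg_m0 eqxx mcoeff_msupp g0.
  rewrite eqxx big1 ?addr0; last by move=> m /negPf ->.
  by move/eqP; rewrite g0.
have [w nzw] := mpoly_nonvanish nz_gr.
exists w => u ua; apply: contraNneq nzw => hu0.
pose v i : {poly F} := drop_poly 1 (u i).
have uE i : u i = (a i)%:P + v i * 'X.
  rewrite -{1}(poly_take_drop 1 (u i)) expr1; congr (_ + _).
  by apply/polyP => k; rewrite coef_take_poly coefC -(ua i).1; case: k.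
have v0 i : (v i)`_0 = w i by rewrite coef_drop_poly (ua i).2.
have vg0 : mmap polyC (fun i => v i * 'X) g = 0.
  apply: poly_vanish => x; rewrite horner_mmap.
  rewrite -[RHS](horner0 x) -hu0 horner_mmap hg; apply: meval_eq => i.
  by rewrite uE !hornerE addrC addKr.
(* In the coefficient of degree [r], monomials of higher degree contribute nothing, and those of
   degree [r] contribute their value at [v] for parameter 0, that is, at [w]. *)
have := congr1 (fun p : {poly F} => p`_r) vg0; rewrite coef0 => <-.
rewrite pihomogE raddf_sum /mmap coef_sum /= [X in X == _]big_mkcond /=.
apply/eqP/eq_big_seq => m mg.
have -> : mmap1 (fun i => v i * 'X) m = (\prod_i v i ^+ m i) * 'X^(mdeg m).
  rewrite /mmap1 mdegE -prodrXr -big_split /=.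
  by apply: eq_bigr => i _; rewrite exprMn.
have le_r : (r <= mdeg m)%N by apply: min_r; apply/hasP; exists m.
rewrite coefCM coefMXn; case: (ltngtP r (mdeg m)) le_r => // [lt_r|->] _.
  by rewrite mulr0.
rewrite mevalZ mevalX subnn; congr (_ * _).
by rewrite -horner_coef0 horner_prod; apply: eq_bigr => i _; rewrite horner_exp horner_coef0 v0.
Qed.

(** If the image missed a generic point, [h] would vanish along every image curve on which [D] is
    not identically zero; a curve with the velocity given by [jet_nonvanish] excludes this. *)
Lemma dominant_general (F : closedFieldType) (n m : nat) (G : 'I_n -> {mpoly F[m]})
    (D : {mpoly F[m]}) (a : 'I_n -> F) :
  (forall w : 'I_n -> F, exists g : 'I_m -> {poly F}, mmap polyC g D != 0 /\
     forall i, (mmap polyC g (G i))`_0 = a i /\ (mmap polyC g (G i))`_1 = w i) ->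
  general (fun c : {ffun 'I_n -> F} =>
    exists t, D.@[t] != 0 /\ forall i, c i = (G i).@[t]).
Proof.
move=> jet; have [h [b [nzh hb]]] := image_generic G D.
case: b hb => hb; last first.
  have [w hw] := jet_nonvanish a nzh.
  have [g [nzD /hw/negP[]]] := jet w.
  (* The curve may leave the locus [D] nonzero at some parameters; the factor [D] makes the product
     vanish there too. *)
  suff /eqP : mmap polyC g D * mmap polyC (fun i => mmap polyC g (G i)) h = 0.
    by rewrite mulf_eq0 (negPf nzD).
  apply: poly_vanish => x; rewrite hornerM !horner_mmap; apply/eqP.
  rewrite mulf_eq0; apply/norP => -[nzDx /hb[H _]].
  suff : false by [].
  by apply: H; eexists; split; [exact: nzDx | move=> i; rewrite horner_mmap].
exists (fun c => h.@[c] != 0); split; last split.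
- exists (eq [seq (h@_m, [ffun i => m i]) | m <- msupp h]) => c.
  have -> : h.@[c] = Defs.meval [seq (h@_m, [ffun i => m i]) | m <- msupp h] c.
    rewrite mevalE /Defs.meval [RHS]big_map.
    apply: eq_big => // u _ /=.
    by congr (_ * _); apply: eq_bigr => i _; rewrite ffunE.
  split=> [/eqP nz /(_ _ erefl)//|nz].
  by apply/negP => /eqP c0; apply: nz => _ <-.
- have [v nzv] := mpoly_nonvanish nzh; exists [ffun i => v i].
  by rewrite (meval_eq (v2 := v)) // => i; rewrite ffunE.
- by move=> c /hb[_ /(_ isT)].
Qed.

(** * Binary forms as univariate polynomials *)

(** Inverse of setting x = 1 on forms of degree [e]. This degree is formal: [p] may have a smaller
    one. *)
Definition homogenize (R : comNzRingType) (e : nat) (p : {poly R}) : {poly {poly R}} :=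
  \sum_(j < e.+1) bconst p`_j * bx R ^+ (e - j) * by_ R ^+ j.

Lemma homogenizeM_linear (R : comNzRingType) (e : nat) (a b : R) (p : {poly R}) :
  (size p <= e.+1)%N ->
  homogenize e.+1 ((a%:P + b *: 'X) * p)
    = (bconst a * bx R + bconst b * by_ R) * homogenize e p.
Proof.
move=> sz_p.
have E j : ((a%:P + b *: 'X) * p)`_j = a * p`_j + b * (if j == 0%N then 0 else p`_j.-1).
  by rewrite mulrDl coefD coefCM -scalerAl coefZ coefXM.
have bconstD : {morph @bconst R : x y / x + y} by move=> x y; rewrite /bconst !polyCD.
have bconstM : {morph @bconst R : x y / x * y} by move=> x y; rewrite /bconst !polyCM.
rewrite /homogenize; under eq_bigr => j _ do rewrite E bconstD !bconstM !mulrDl.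
rewrite big_split /= mulrDl; congr (_ + _).
  rewrite big_ord_recr /= (nth_default _ sz_p) /bconst !polyC0 !(mulr0, mul0r) addr0 mulr_sumr.
  apply: eq_bigr => j _; rewrite subSn -1?ltnS // exprS -!mulrA; congr (_ * _).
  exact: mulrCA.
rewrite big_ord_recl /= /bconst !polyC0 !(mulr0, mul0r) add0r mulr_sumr.
apply: eq_bigr => j _; rewrite /bump /= add1n subSS exprS -!mulrA; congr (_ * _).
by rewrite (mulrCA (_ ^+ (e - j))); exact: mulrCA.
Qed.

(* [dehom] is the substituted form evaluated at x = 1, the variable of the polynomial being y. *)
Definition dehom (R : comNzRingType) (d : nat) (a1 a2 a3 a4 : R) (T : nat -> R) : {poly R} :=
  \sum_(k < d.+1) T k *: ((a1%:P + a2 *: 'X) ^+ (d - k) * (a3%:P + a4 *: 'X) ^+ k).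

(** Each summand is a product of [d] linear factors, which [homogenizeM_linear] peels off one by
    one; homogenization is linear in the coefficients. *)
Lemma homogenize_dehom (R : comNzRingType) (d : nat) (a1 a2 a3 a4 : R) (T : nat -> R) :
  homogenize d (dehom d a1 a2 a3 a4 T) =
  \sum_(k < d.+1) bconst (T k) * (bconst a1 * bx R + bconst a2 * by_ R) ^+ (d - k)
                               * (bconst a3 * bx R + bconst a4 * by_ R) ^+ k.
Proof.
have sz_lin (a b : R) : (size (a%:P + b *: 'X)%R <= 2)%N.
  rewrite (leq_trans (size_polyD _ _)) // geq_max (leq_trans (size_polyC_leq1 _)) //=.
  by rewrite (leq_trans (size_scale_leq _ _)) // size_polyX.
have sz_mul (e : nat) (a b : R) (p : {poly R}) : (size p <= e.+1)%N ->
    (size ((a%:P + b *: 'X) * p)%R <= e.+2)%N.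
  move=> sz_p; rewrite (leq_trans (size_polyMleq _ _)) //.
  by rewrite -subn1 leq_subLR (leq_trans (leq_add (sz_lin a b) sz_p)).
have pow (i j : nat) : let p := (a1%:P + a2 *: 'X) ^+ i * (a3%:P + a4 *: 'X) ^+ j in
    (size p <= (i + j).+1)%N /\ homogenize (i + j) p =
       (bconst a1 * bx R + bconst a2 * by_ R) ^+ i
       * (bconst a3 * bx R + bconst a4 * by_ R) ^+ j.
  elim: i => [|i [sz_i IHi]] /=; last first.
    by rewrite addSn !exprS -!mulrA; split; [exact: sz_mul | rewrite homogenizeM_linear // IHi].
  rewrite expr0 !mul1r add0n; elim: j => [|j [sz_j IHj]]; last first.
    by rewrite !exprS; split; [exact: sz_mul | rewrite homogenizeM_linear // IHj].
  rewrite !expr0 size_polyC oner_eq0; split=> //.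
  by rewrite /homogenize big_ord1 /bconst coefC /= !expr0 !mulr1 !polyC1.
under [RHS]eq_bigr => k _.
  have kd : (k <= d)%N by rewrite -ltnS.
  have := (pow (d - k)%N k).2; rewrite subnK // -mulrA => <-; over.
rewrite /= /homogenize; under [RHS]eq_bigr do rewrite mulr_sumr.
rewrite exchange_big /=; apply: eq_bigr => j _.
rewrite /dehom coef_sum /bconst !rmorph_sum /= !mulr_suml.
by apply: eq_bigr => k _; rewrite coefZ !polyCM -!mulrA.
Qed.

(** The same formula serves over the polynomial ring of the parameters, along a curve and at a
    point; this passes between them. *)
Lemma map_dehom (R S : comNzRingType) (f : {rmorphism R -> S}) (d : nat) (a1 a2 a3 a4 : R)
    (T : nat -> R) :
  map_poly f (dehom d a1 a2 a3 a4 T) = dehom d (f a1) (f a2) (f a3) (f a4) (f \o T).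
Proof.
rewrite /dehom rmorph_sum /=; apply: eq_bigr => k _.
by rewrite map_polyZ rmorphM !rmorphXn !rmorphD /= !map_polyC !map_polyZ !map_polyX.
Qed.

(** * First-order expansion at the identity substitution *)

Lemma exp_first_order (R : comNzRingType) (e A B : R) (n : nat) :
  exists r, (A + e * B) ^+ n = A ^+ n + e * (A ^+ n.-1 * B *+ n) + e ^+ 2 * r.
Proof.
elim: n => [|n [r IHn]]; first by exists 0; rewrite !expr0 mulr0n !mulr0 !addr0.
have -> : A ^+ n.+1.-1 * B *+ n.+1 = A * (A ^+ n.-1 * B *+ n) + B * A ^+ n.
  rewrite mulrSr [B * _]mulrC /=; congr (_ + _).
  by case: n {IHn} => [|n]; rewrite ?mulr0n ?mulr0 // -mulrnAr mulrA -exprS -mulrnAr.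
exists (B * (A ^+ n.-1 * B *+ n) + A * r + e * B * r); rewrite !exprS IHn.
by move: (A ^+ n) (_ *+ n) => a b; ring.
Qed.

(** One summand of [dehom] along a curve: [e] is the curve parameter, [z] is y, and [A], [B] are the
    velocities of the two linear forms 1 and y. *)
Lemma form_first_order (R : comNzRingType) (e z A B c t : R) (i k : nat) :
  exists r, (c + e * t) * ((1 + e * A) ^+ i * (z + e * B) ^+ k) =
    c * z ^+ k + e * (t * z ^+ k + A * (c * z ^+ k *+ i) + B * (c * z ^+ k.-1 *+ k))
    + e ^+ 2 * r.
Proof.
have [r1 ->] := exp_first_order e 1 A i; have [r2 ->] := exp_first_order e z B k.
rewrite !expr1n !mul1r -(mulr_natr A) -(mulr_natr (_ * B)) -(mulr_natr (c * _) i)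
  -(mulr_natr (c * _) k).
move: (z ^+ k) (z ^+ k.-1) (i%:R : R) (k%:R : R) => x y i' k'.
exists (t * (x * A * i' + y * B * k') + (c + e * t) * (A * i' * y * B * k' + r1 * x + r2
  + e * (A * i' * r2 + r1 * y * B * k') + e ^+ 2 * r1 * r2)); ring.
Qed.

Lemma dehom_first_order (C : comNzRingType) (d : nat) (s1 s2 s3 s4 : C) (q tau : {poly C})
    (j : nat) :
  (size q <= d.+1)%N -> (size tau <= d.+1)%N ->
  let P := dehom d (1 + s1 *: 'X) (s2 *: 'X) (s3 *: 'X) (1 + s4 *: 'X)
             (fun k => (q`_k)%:P + tau`_k *: 'X) in
  (P`_j)`_0 = q`_j /\
  (P`_j)`_1 = (tau + (s1%:P + s2 *: 'X) * (q *+ d - 'X * q^`())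
                   + (s3%:P + s4 *: 'X) * q^`())`_j.
Proof.
move=> sz_q sz_tau P.
set S1 := s1%:P + _; set S2 := s3%:P + _.
(* The inner variable is now the curve parameter and the outer one is y; [emb] views a polynomial in
   y as constant along the curve. *)
pose e : {poly {poly C}} := 'X%:P; pose z : {poly {poly C}} := 'X.
pose emb : {rmorphism {poly C} -> {poly {poly C}}} := map_poly (@polyC C).
have sumE (p : {poly C}) : (size p <= d.+1)%N -> p = \sum_(k < d.+1) p`_k *: 'X^k.
  move=> sz_p; rewrite -poly_def; apply/polyP => i; rewrite coef_poly.
  by case: ltnP => // /(leq_trans sz_p)/leq_sizeP ->.
have eulerE : q *+ d - 'X * q^`() = \sum_(k < d.+1) q`_k *: 'X^k *+ (d - k).
  rewrite {1 2}(sumE q) // (raddf_sum deriv) mulr_sumr -sumrMnl -sumrB; apply: eq_bigr => k _.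
  rewrite /= derivZ derivXn mulrnBr -1?ltnS //; congr (_ - _).
  case: (k : nat) => [|i]; first by rewrite !mulr0n scaler0 mulr0.
  by rewrite -scalerMnr mulrnAr -scalerAr -exprS.
have derivE : q^`() = \sum_(k < d.+1) q`_k *: 'X^(k.-1) *+ k.
  rewrite {1}(sumE q) // (raddf_sum deriv); apply: eq_bigr => k _.
  by rewrite /= derivZ derivXn scalerMnr.
have embZ c i : emb (c *: 'X^i) = c%:P%:P * z ^+ i.
  by rewrite /= map_polyZ map_polyXn mul_polyC.
have [r PE] : exists r,
    P = emb q + e * emb (tau + S1 * (q *+ d - 'X * q^`()) + S2 * q^`()) + e ^+ 2 * r.
  have [r rE] := fin_all_exists (fun k : 'I_d.+1 => form_first_order e z (emb S1) (emb S2)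
    (q`_k)%:P%:P (tau`_k)%:P%:P (d - k) k).
  exists (\sum_(k < d.+1) r k).
  rewrite eulerE derivE {1}(sumE q) // {1}(sumE tau) // /P /dehom.
  rewrite !(rmorphD emb) !(rmorphM emb) !(rmorph_sum emb) !mulrDr !mulr_sumr -!big_split.
  apply: eq_bigr => k _.
  have lin (x y : C) : (x%:P + y *: 'X)%:P = x%:P%:P + e * y%:P%:P :> {poly {poly C}}.
    by rewrite polyCD -mul_polyC polyCM mulrC.
  have linZ (y : C) : (y *: 'X) *: 'X = e * (y%:P%:P * z) :> {poly {poly C}}.
    by rewrite -!mul_polyC polyCM -mulrA mulrCA.
  have embS (x y : C) : emb (x%:P + y *: 'X) = x%:P%:P + y%:P%:P * z.
    by rewrite (rmorphD emb) -[y *: 'X]/(y *: 'X^1) embZ /= map_polyC.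
  have -> : (1 + s1 *: 'X)%:P + (s2 *: 'X) *: 'X = 1 + e * emb S1.
    by rewrite embS mulrDr addrA -linZ -polyC1 lin.
  have -> : (s3 *: 'X)%:P + (1 + s4 *: 'X) *: 'X = z + e * emb S2.
    rewrite embS mulrDr -linZ scalerDl scale1r addrCA; congr (_ + (_ + _)).
    by rewrite -mul_polyC polyCM mulrC.
  by rewrite -[LHS]mul_polyC lin rE /= !(rmorphMn emb) !embZ !mulrDr.
have coefE : P`_j = (q`_j)%:P
    + 'X * ((tau + S1 * (q *+ d - 'X * q^`()) + S2 * q^`())`_j)%:P + 'X^2 * r`_j.
  by rewrite PE; set B := tau + _ + _; rewrite 2!coefD coefCM -polyC_exp coefCM !coef_map.
by rewrite coefE; split; rewrite !coefD coefC coefXM coefXnM ?coefC /= ?addr0 ?add0r.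
Qed.

(** * Surjectivity of the differential *)

Lemma cramer2 (F : fieldType) (a b c d u v : F) : a * d - c * b != 0 ->
  exists x y, a * x + b * y = u /\ c * x + d * y = v.
Proof.
move=> nz; exists ((u * d - v * b) / (a * d - c * b)), ((a * v - c * u) / (a * d - c * b)).
by split; field.
Qed.

(* At x = 1, Euler's identity turns the x-derivative of the form q into [q *+ d - 'X * q^`()].
   The directions [s1], [s4] rescale X and Y, and [s2], [s3] shear them; the coefficients at
   [n1], [n2] are reached by the former and those at [m1], [m2] by the latter. *)
Lemma tangent_onto (C : numFieldType) (d m1 m2 n1 n2 : nat) (q w : {poly C}) :
  (m1 <= d)%N -> (m2 <= d)%N -> (n1 <= d)%N -> (n2 <= d)%N ->
  uniq [:: m1; m2; n1; n2] ->
  q`_m1 = 0 -> q`_m2 = 0 -> q`_n1 = 1 -> q`_n2 = 1 ->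
  let U := 'X * (q *+ d - 'X * q^`()) in let V := q^`() in
  U`_m1 * V`_m2 - U`_m2 * V`_m1 != 0 ->
  (size w <= d.+1)%N ->
  exists s1 s2 s3 s4 (tau : {poly C}), [/\ (size tau <= d.+1)%N,
    forall k, k \in [:: m1; m2; n1; n2] -> tau`_k = 0 &
    forall j, (j <= d)%N ->
    (tau + (s1%:P + s2 *: 'X) * (q *+ d - 'X * q^`()) + (s3%:P + s4 *: 'X) * q^`())`_j = w`_j].
Proof.
move=> m1d m2d n1d n2d uniqB qm1 qm2 qn1 qn2 U V nzD sz_w.
have eulerE j : (q *+ d - 'X * q^`())`_j = q`_j *+ d - q`_j *+ j.
  rewrite coefB coefMn coefXM coef_deriv; congr (_ - _).
  by case: j => [|j] //=; rewrite mulr0n.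
(* The system is triangular: [q] vanishes at [m1] and [m2], so [s1] and [s4] have no effect there
   and the shears are found first. *)
have [s2 [s3 [e1 e2]]] : exists s2 s3, U`_m1 * s2 + V`_m1 * s3 = w`_m1 /\
    U`_m2 * s2 + V`_m2 * s3 = w`_m2 by exact: cramer2.
have [s1 [s4 [e3 e4]]] : exists s1 s4,
    (d%:R - n1%:R) * s1 + n1%:R * s4 = w`_n1 - (U`_n1 * s2 + V`_n1 * s3) /\
    (d%:R - n2%:R) * s1 + n2%:R * s4 = w`_n2 - (U`_n2 * s2 + V`_n2 * s3).
  (* The determinant is nonzero in characteristic zero: [n1] and [n2] differ, and [d] is positive
     because the distinct [m1], [m2] are at most [d]. *)
  apply: cramer2; have -> : (d%:R - n1%:R) * n2%:R - (d%:R - n2%:R) * n1%:R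
      = d%:R * (n2%:R - n1%:R) :> C by ring.
  rewrite mulf_neq0 ?pnatr_eq0 ?subr_eq0 ?eqr_nat //.
    by apply: contraTneq uniqB => d0; move: m1d m2d; rewrite d0 !leqn0 => /eqP-> /eqP->.
  by apply: contraTneq uniqB => ->; rewrite /= !inE eqxx !andbF.
pose B := (s1%:P + s2 *: 'X) * (q *+ d - 'X * q^`()) + (s3%:P + s4 *: 'X) * q^`().
have BE j : B`_j = q`_j * ((d%:R - j%:R) * s1 + j%:R * s4) + (U`_j * s2 + V`_j * s3).
  rewrite /B !mulrDl !coefD !coefCM -!scalerAl !coefZ eulerE -/U -/V.
  rewrite [('X * V)`_j](_ : _ = q`_j * j%:R); last first.
    by rewrite coefXM coef_deriv; case: j => [|j]; rewrite /= ?mulr0 // mulr_natr.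
  by rewrite -!(mulr_natr q`_j); ring.
(* [tau] absorbs all remaining coefficients; it vanishes at the four special indices because the two
   systems are solved there. *)
pose tau := \poly_(k < d.+1) (w`_k - B`_k).
exists s1, s2, s3, s4, tau; split; first exact: size_poly.
  move=> k kB; have kd : (k < d.+1)%N.
    by move: kB; rewrite !inE ltnS => /or4P[]/eqP->.
  rewrite coef_poly kd BE; apply/eqP; rewrite subr_eq0; apply/eqP.
  move: kB; rewrite !inE => /or4P[]/eqP->.
  - by rewrite qm1 mul0r add0r e1.
  - by rewrite qm2 mul0r add0r e2.
  - by rewrite qn1 mul1r e3 subrK.
  - by rewrite qn2 mul1r e4 subrK.
by move=> j jd; rewrite -addrA coefD coef_poly ltnS jd subrK.
Qed.

(* The coefficient at [z] is dropped to keep the two products in the minor of [tangent_onto]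
   from cancelling: exactly one of them survives. *)
Definition base_form (C : nzRingType) (d m1 m2 z : nat) : {poly C} :=
  \poly_(k < d.+1) (k \notin [:: m1; m2; z])%:R.

Lemma coef_base_form (C : nzRingType) (d m1 m2 z k : nat) :
  (base_form C d m1 m2 z)`_k = ((k <= d)%N && (k \notin [:: m1; m2; z]))%:R.
Proof. by rewrite coef_poly ltnS; case: leqP. Qed.

(** For [m1 < m2], one product involves the coefficients of [q] at [m1 - 1] and [m2 + 1], the other
    those at [m1 + 1] and [m2 - 1]. An index out of range kills a product, and so does the choice of
    [z]. *)
Lemma base_form_generic (C : numFieldType) (d m1 m2 n1 n2 : nat) :
  (m1 <= d)%N -> (m2 <= d)%N -> uniq [:: m1; m2; n1; n2] ->
  ~ ((m1 == 0%N) && (m2 == 1%N) || (m1 == 1%N) && (m2 == 0%N)) ->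
  ~ ((m1 == d.-1) && (m2 == d) || (m1 == d) && (m2 == d.-1)) ->
  exists2 z, z \notin [:: n1; n2] &
    let q := base_form C d m1 m2 z in
    let U := 'X * (q *+ d - 'X * q^`()) in let V := q^`() in
    U`_m1 * V`_m2 - U`_m2 * V`_m1 != 0.
Proof.
wlog lt_m : m1 m2 / (m1 < m2)%N => [th|] m1d m2d uniqB not01 notd.
  have [lt_m|lt_m|eq_m] := ltngtP m1 m2; first exact: th.
    have [|||z zN nz] := th m2 m1 lt_m m2d m1d.
    + by move: uniqB; rewrite /= !inE !negb_or ![m2 == _]eq_sym; do !case: eqP.
    + by rewrite orbC ![(m2 == _) && _]andbC.
    + by rewrite orbC ![(m2 == _) && _]andbC.
    exists z => //; move: nz; rewrite /base_form.
    have -> : \poly_(k < d.+1) (k \notin [:: m2; m1; z])%:R =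
              \poly_(k < d.+1) (k \notin [:: m1; m2; z])%:R :> {poly C}.
      by apply: eq_poly => k _; rewrite !inE orbCA.
    by rewrite -oppr_eq0 opprB mulrC [X in _ - X]mulrC.
  by move: uniqB; rewrite eq_m /= inE eqxx.
have nzb (b : bool) : (b%:R == 0 :> C) = ~~ b by case: b; rewrite ?oner_eq0 ?eqxx.
(* The boolean inequality says that exactly one of the two products is nonzero. *)
have [z zN xz] : exists2 z, z \notin [:: n1; n2] &
    [&& 0 < m1, m2 < d, z != m1.-1 & z != m2.+1]%N
      != [&& m1.+1 < m2, z != m1.+1 & z != m2.-1]%N.
  have m1N : m1 \notin [:: n1; n2] by move: uniqB; rewrite /= !inE; lia.
  have [zN|zN] := boolP ((m1 == 0) || (m2 == d) || (m1.+1 == m2))%N.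
    (* Here one product is already zero and, by the excluded pairs, not both; [m1] is dropped
       anyway, so this choice changes nothing. *)
    by exists m1 => //; move: not01 notd zN; lia.
  have [zN1|zN1] := boolP (m1.-1 \notin [:: n1; n2]); first by exists m1.-1 => //; lia.
  have [zN2|zN2] := boolP (m2.+1 \notin [:: n1; n2]); first by exists m2.+1 => //; lia.
  (* Now [n1] and [n2] are [m1 - 1] and [m2 + 1] in some order, so [m1 + 1] may be dropped, which
     kills the second product. *)
  exists m1.+1; last by lia.
  by move: zN zN1 zN2; rewrite !inE; lia.
exists z => //=.
have UE j : ('X * (base_form C d m1 m2 z *+ d - 'X * (base_form C d m1 m2 z)^`()))`_j
    = if j is i.+1 then (base_form C d m1 m2 z)`_i * (d%:R - i%:R) else 0.
  rewrite coefXM; case: j => //= i.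
  rewrite coefB coefMn coefXM coef_deriv mulrBr mulr_natr; congr (_ - _).
  by case: i => [|i]; rewrite /= ?mulr0 // mulr_natr.
rewrite !UE !coef_deriv -(mulr_natr _ m1.+1) -(mulr_natr _ m2.+1).
have first : (if m1 is i.+1 then (base_form C d m1 m2 z)`_i * (d%:R - i%:R) else 0)
    * ((base_form C d m1 m2 z)`_m2.+1 * m2.+1%:R) != 0
    = [&& 0 < m1, m2 < d, z != m1.-1 & z != m2.+1]%N.
  case: (m1) lt_m m1d => [|i] lt_m m1d; first by rewrite mul0r eqxx.
  rewrite !coef_base_form !mulf_eq0 !nzb subr_eq0 eqr_nat pnatr_eq0 !inE.
  clear -lt_m m1d m2d; lia.
have second : (if m2 is i.+1 then (base_form C d m1 m2 z)`_i * (d%:R - i%:R) else 0)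
    * ((base_form C d m1 m2 z)`_m1.+1 * m1.+1%:R) != 0
    = [&& m1.+1 < m2, z != m1.+1 & z != m2.-1]%N.
  case: (m2) lt_m m2d => [|i] lt_m m2d //.
  rewrite !coef_base_form !mulf_eq0 !nzb subr_eq0 eqr_nat pnatr_eq0 !inE.
  clear -lt_m m1d m2d; lia.
move: xz; rewrite -first -second subr_eq0.
by apply: contraNneq => ->.
Qed.

(** * The normal form and the conclusion *)

Lemma eq_dehom (R : comNzRingType) (d : nat) (a1 a2 a3 a4 : R) (T T' : nat -> R) :
  (forall k, (k <= d)%N -> T k = T' k) -> dehom d a1 a2 a3 a4 T = dehom d a1 a2 a3 a4 T'.
Proof. by move=> eqT; apply: eq_bigr => k _; rewrite eqT // -ltnS. Qed.

Definition normal_coef (R : nzRingType) (m1 m2 n1 n2 : nat) (t : nat -> R) (k : nat) : R :=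
  if k \in [:: n1; n2] then 1 else if k \in [:: m1; m2] then 0 else t k.

Lemma sum_normal_coef (R : comNzRingType) (d m1 m2 n1 n2 : nat) (t : nat -> R)
    (X Y : {poly {poly R}}) :
  (n1 <= d)%N -> (n2 <= d)%N -> n1 != n2 ->
  \sum_(k < d.+1) bconst (normal_coef m1 m2 n1 n2 t k) * X ^+ (d - k) * Y ^+ k =
  X ^+ (d - n1) * Y ^+ n1 + X ^+ (d - n2) * Y ^+ n2
    + \sum_(k < d.+1 | (k : nat) \notin [:: m1; m2; n1; n2])
        bconst (t k) * X ^+ (d - k) * Y ^+ k.
Proof.
rewrite -![(_ <= d)%N]ltnS => n1d n2d n12.
have split2 (F : 'I_d.+1 -> {poly {poly R}}) : \sum_k F k =
    F (Ordinal n1d) + F (Ordinal n2d) + \sum_(k : 'I_d.+1 | (k : nat) \notin [:: n1; n2]) F k.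
  rewrite (bigD1 (Ordinal n1d)) // (bigD1 (Ordinal n2d)) /=; last by rewrite -val_eqE eq_sym.
  rewrite addrA; congr (_ + _); apply: eq_bigl => k.
  by rewrite -!val_eqE !inE negb_or.
rewrite split2 {1 2}/normal_coef !inE !eqxx orbT /bconst !polyC1 !mul1r; congr (_ + _).
rewrite [LHS]big_mkcond [RHS]big_mkcond; apply: eq_bigr => k _.
rewrite /normal_coef (mem_cat _ [:: m1; m2] [:: n1; n2]).
case: (_ \in [:: n1; n2]); first by rewrite orbT.
by case: (_ \in [:: m1; m2]); rewrite //= !polyC0 !mul0r.
Qed.

Theorem theorem2p4 (C : numClosedFieldType) (d m1 m2 n1 n2 : nat) :
  (3 <= d)%N ->
  (m1 <= d)%N -> (m2 <= d)%N -> (n1 <= d)%N -> (n2 <= d)%N ->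
  uniq [:: m1; m2; n1; n2] ->
  ~ ((m1 == 0%N) && (m2 == 1%N) || (m1 == 1%N) && (m2 == 0%N)) ->
  ~ ((m1 == d.-1) && (m2 == d) || (m1 == d) && (m2 == d.-1)) ->
  general (fun c : {ffun 'I_d.+1 -> C} =>
    exists (a1 a2 a3 a4 : C) (t : nat -> C),
      a1 * a4 - a2 * a3 != 0 /\
      let X := bconst a1 * bx C + bconst a2 * by_ C in
      let Y := bconst a3 * bx C + bconst a4 * by_ C in
      binform c =
        X ^+ (d - n1) * Y ^+ n1 + X ^+ (d - n2) * Y ^+ n2
        + \sum_(k < d.+1 | (k : nat) \notin [:: m1; m2; n1; n2])
            bconst (t k) * X ^+ (d - k) * Y ^+ k).
Proof.
move=> _ m1d m2d n1d n2d uniqB not01 notd.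
have [z zN] := base_form_generic C m1d m2d uniqB not01 notd.
set q := base_form C d m1 m2 z => /= nzJ.
have qE k : (k <= d)%N -> q`_k = (k \notin [:: m1; m2; z])%:R.
  by move=> kd; rewrite coef_base_form kd.
have qm k : k \in [:: m1; m2] -> q`_k = 0.
  by rewrite !inE => /orP[]/eqP->; rewrite qE // !inE eqxx ?orbT.
have [n12 disj] : n1 != n2 /\ {in [:: n1; n2], forall k, k \notin [:: m1; m2]}.
  move: uniqB; rewrite (cat_uniq [:: m1; m2]) => /and3P[_ /hasPn disj /andP[n12 _]].
  by split=> //; move: n12; rewrite inE.
have qn k : k \in [:: n1; n2] -> q`_k = 1.
  move=> kn; rewrite qE; last by move: kn; rewrite !inE => /orP[]/eqP->.
  rewrite (mem_cat _ [:: m1; m2] [:: z]) negb_or disj //= inE.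
  by have -> : k != z by apply: contraTneq kn => ->.
(* Variables 0 to 3 are the entries of the substitution, variable k + 4 is t_k. *)
pose V i : {mpoly C[d.+4.+1]} := 'X_(inord i).
pose G (i : 'I_d.+1) : {mpoly C[d.+4.+1]} :=
  (dehom d (V 0%N) (V 1%N) (V 2%N) (V 3%N) (normal_coef m1 m2 n1 n2 (fun k => V k.+4)))`_i.
pose D := V 0%N * V 3%N - V 1%N * V 2%N.
have [] := @dominant_general C d.+1 d.+4.+1 G D (fun i => q`_i).
  move=> w; pose W := \poly_(k < d.+1) w (inord k).
  have [||||s1 [s2 [s3 [s4 [tau [sz_tau tau0 tauW]]]]]] :=
    @tangent_onto C d m1 m2 n1 n2 q W m1d m2d n1d n2d uniqB _ _ _ _ nzJ (size_poly _ _).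
  - by apply: qm; rewrite !inE eqxx.
  - by apply: qm; rewrite !inE eqxx orbT.
  - by apply: qn; rewrite !inE eqxx.
  - by apply: qn; rewrite !inE eqxx orbT.
  (* The curve starts at the identity substitution with coefficients those of [q]; its velocity is
     the preimage of [w] under the differential. *)
  pose g (i : nat) : {poly C} := match i with
    | 0 => 1 + s1 *: 'X | 1 => s2 *: 'X | 2 => s3 *: 'X | 3 => 1 + s4 *: 'X
    | k.+4 => (q`_k)%:P + tau`_k *: 'X end.
  pose f : {rmorphism {mpoly C[d.+4.+1]} -> {poly C}} := mmap polyC (fun i : 'I_d.+4.+1 => g i).
  have fV i : (i < d.+4.+1)%N -> f (V i) = g i.
    by move=> id; rewrite /= mmapX mmap1U inordK.
  exists (fun i : 'I_d.+4.+1 => g i); split.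
    (* At parameter 0 the determinant of the substitution is 1. *)
    apply/eqP => fD0; have := congr1 (fun p : {poly C} => p.[0]) (fD0 : f D = 0).
    rewrite rmorphB !rmorphM !fV //= !hornerE /= => /eqP.
    by rewrite subr0 oner_eq0.
  move=> i; rewrite -/(f (G i)) -coef_map map_dehom !fV //=.
  (* The constants 1 and 0 of the normal form fit the curve, since [q] takes these values at the
     four special indices and [tau] vanishes there. *)
  rewrite (@eq_dehom _ _ _ _ _ _ _ (fun k => (q`_k)%:P + tau`_k *: 'X)); last first.
    move=> k kd; rewrite /= /normal_coef.
    have [kn|kn] := boolP (k \in [:: n1; n2]).
      rewrite rmorph1 qn // tau0 ?scale0r ?addr0 //.
      by move: kn; rewrite !inE => ->; rewrite !orbT.
    have [km|km] := boolP (k \in [:: m1; m2]); last exact: fV.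
    rewrite rmorph0 qm // tau0 ?scale0r ?addr0 //.
    by move: km; rewrite !inE orbA => ->.
  have [-> ->] := dehom_first_order s1 s2 s3 s4 i (size_poly _ _ : size q <= d.+1)%N sz_tau.
  by rewrite tauW -1?ltnS //; split=> //; rewrite coef_poly ltn_ord inord_val.
move=> U [Uopen [Une Uimage]]; exists U; split=> //; split=> // c /Uimage[t [nzD cE]].
exists (t (inord 0)), (t (inord 1)), (t (inord 2)), (t (inord 3)), (fun k => t (inord k.+4)).
split; first by move: nzD; rewrite mevalB !mevalM !mevalXU.
apply: etrans (@sum_normal_coef C d m1 m2 n1 n2 (fun k => t (inord k.+4)) _ _ n1d n2d n12).
rewrite -homogenize_dehom; apply: eq_bigr => k _; congr (bconst _ * _ * _).
rewrite cE -coef_map map_dehom /= !mevalXU.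
rewrite (@eq_dehom _ _ _ _ _ _ _ (normal_coef m1 m2 n1 n2 (fun j => t (inord j.+4)))) // => j _.
rewrite /= /normal_coef; case: ifP => _; first exact: rmorph1.
by case: ifP => _; [exact: rmorph0 | exact: mevalXU].
Qed.
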